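(* The circulant graph $\mathrm{Circ}(n,\{1,2,4,5,6,7\})$ is a nut graph for each even integer $n\geq 16$.
   Context: For $n\in\mathbb{N}$ and a generator set $S\subseteq\{1,\dots,\lfloor n/2\rfloor\}$, $\mathrm{Circ}(n,S)$ denotes the circulant graph with vertex set $V=\{0,1,\dots,n-1\}$ in which $i$ is adjacent to $i\pm s$ (computed modulo $n$) for every $i\in V$ and $s\in S$. A simple graph with at least two vertices is a nut graph if its adjacency matrix has the eigenvalue $0$ with multiplicity exactly $1$ and an eigenvector corresponding to $0$ has no zero entries. *)

(* Defs.v *)
(* MathComp *)
From HB Require Import structures.
From mathcomp Require Import all_boot all_order all_algebra.

Set Implicit Arguments.
Unset Strict Implicit.
Unset Printing Implicit Defensive.

Import Order.TTheory GRing.Theory Num.Theory.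
Local Open Scope ring_scope.

Definition simple_graph (n : nat) (e : rel 'I_n) : Prop :=
  symmetric e /\ irreflexive e.

Definition adjacency_mx (R : nzRingType) (n : nat) (e : rel 'I_n) : 'M[R]_n :=
  \matrix_(i, j) (e i j)%:R.

(* Multiplicity of 0 is meant algebraically, as a root of the characteristic
   polynomial. The matrix has integer entries, so neither clause on the
   spectrum depends on the field of characteristic 0 that is chosen. *)
Definition nut_graph (R : numFieldType) (n : nat) (e : rel 'I_n) : Prop :=
  [/\ simple_graph e,
      (2 <= n)%N,
      mup 0 (char_poly (adjacency_mx R e)) = 1%N
    & exists v : 'cV[R]_n,
        [/\ v != 0, adjacency_mx R e *m v = 0 *: v & forall i, v i 0 != 0]].

(* The two disjuncts say j = i + s and j = i - s modulo n; the latter is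
   written additively because subtraction on nat is truncated. The generators
   in S are meant to lie between 1 and n./2. *)
Definition circ (n : nat) (S : seq nat) : rel 'I_n :=
  fun i j =>
    has (fun s => (j == i + s %[mod n])%N || (j + s == i %[mod n])%N) S.
Arguments circ : clear implicits.

(* Main.v *)
(** A circulant matrix is diagonalised by the Vandermonde matrix of the [n]-th
    roots of unity, so its eigenvalues are the values [lambda z] at these roots
    of the sum of [z ^+ s + z ^- s] over the generators [s].  Here
    [lambda z = (y + 2) * g y] with [y = z + z^-1] and [g] an integer polynomial
    of degree 6, and [y + 2] vanishes only at [z = -1].  If [g y = 0] for a root
    of unity [z], then (Beukers and Smyth) one of [- z], [z ^+ 2], [- z ^+ 2] is
    Galois conjugate to [z], so [g] also vanishes at [- y], [y ^+ 2 - 2] or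
    [2 - y ^+ 2]; but [g] is coprime to each of the three corresponding
    polynomials. *)
Require Import Defs.
From mathcomp Require Import all_boot all_order all_algebra all_field.
From mathcomp Require Import ring zify.

Set Implicit Arguments.
Unset Strict Implicit.
Unset Printing Implicit Defensive.

Import Order.TTheory GRing.Theory Num.Theory.
Local Open Scope ring_scope.

(** * Characteristic polynomials: change of field and similarity *)

Lemma mup_map (F K : fieldType) (f : {rmorphism F -> K}) (x : F) (p : {poly F}) :
  p != 0 -> mup (f x) (map_poly f p) = mup x p.
Proof.
move=> p0; have fp0 : map_poly f p != 0 by rewrite map_poly_eq0.
have mup_ge k : (k <= mup (f x) (map_poly f p))%N = (k <= mup x p)%N.
  rewrite !mup_geq // -(dvdp_map f) rmorphXn /= rmorphB /=.
  by rewrite map_polyX map_polyC.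
by apply/eqP; rewrite eqn_leq -mup_ge leqnn mup_ge leqnn.
Qed.

Lemma map_adjacency_mx (R S : nzRingType) (f : {rmorphism R -> S}) (n : nat)
    (e : rel 'I_n) : map_mx f (adjacency_mx R e) = adjacency_mx S e.
Proof. by apply/matrixP=> i j; rewrite !mxE rmorph_nat. Qed.

Lemma char_poly_neq0 (R : nzRingType) (n : nat) (A : 'M[R]_n) :
  char_poly A != 0.
Proof. exact/monic_neq0/char_poly_monic. Qed.

(** Both sides equal the multiplicity over [rat], as field embeddings preserve root multiplicities.
    The spectrum can thus be studied in [algC], which has the roots of unity and their Galois
    automorphisms. *)
Lemma mup0_char_poly_adjacency (R S : numFieldType) (n : nat) (e : rel 'I_n) :
  mup 0 (char_poly (adjacency_mx R e)) = mup 0 (char_poly (adjacency_mx S e)).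
Proof.
suff ratE (K : numFieldType) : mup 0 (char_poly (adjacency_mx K e))
    = mup 0 (char_poly (adjacency_mx rat e)) by rewrite !ratE.
rewrite -(map_adjacency_mx (ratr : {rmorphism rat -> K})) -map_char_poly.
by rewrite -(mup_map (ratr : {rmorphism rat -> K})) ?rmorph0 ?char_poly_neq0.
Qed.

(** Take determinants in ('X - A) P = P ('X - B) and cancel [\det P]: over an integral domain this
    avoids inverting [P]. *)
Lemma char_poly_intertwine (R : idomainType) (n : nat) (A B P : 'M[R]_n) :
  \det P != 0 -> A *m P = P *m B -> char_poly A = char_poly B.
Proof.
move=> detP AP; apply: (@mulIf _ (\det P)%:P); first by rewrite polyC_eq0.
rewrite -det_map_mx -det_mulmx [RHS]mulrC -det_mulmx; congr (\det _).
by rewrite mulmxBl mulmxBr -!map_mxM AP scalar_mxC.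
Qed.

Lemma root_unity_neq0 (R : nzRingType) (n : nat) (z : R) :
  (0 < n)%N -> z ^+ n = 1 -> z != 0.
Proof.
move=> n0 zn; apply: contra_eq_neq zn => ->.
by rewrite expr0n gtn_eqF // eq_sym oner_eq0.
Qed.

(** * Spectrum of a circulant graph *)

Section Circulant.

Variables (n : nat) (S : seq nat).

(** The step -s is encoded as n - s, which keeps the exponents of z natural. *)
Definition circ_shifts : seq nat := S ++ [seq (n - s)%N | s <- S].

Definition circ_eigenvalue (R : nzRingType) (z : R) : R :=
  \sum_(t <- circ_shifts) z ^+ t.

Lemma circ_sym : symmetric (circ n S).
Proof.
by move=> i j; apply: eq_has => s /=; rewrite orbC; congr (_ || _); apply: eq_sym.
Qed.

Hypothesis S_gen : all (fun s => (0 < s) && (s.*2 < n))%N S.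

Lemma circ_irr : irreflexive (circ n S).
Proof.
move=> i; apply/negbTE/hasPn => s sS; move/allP: S_gen => /(_ _ sS).
case/andP=> s0 sn.
rewrite [X in _ || X]eq_sym orbb -[X in X == _ %[mod _]]addn0.
by rewrite eqn_modDl mod0n modn_small; lia.
Qed.

Lemma circ_shifts_lt t : t \in circ_shifts -> (t < n)%N.
Proof.
rewrite mem_cat; move/allP: S_gen => Sn.
by case/orP=> [/Sn | /mapP[s /Sn + ->]]; lia.
Qed.

Lemma circE (i j : 'I_n) :
  circ n S i j = has (fun t => j == i + t %[mod n])%N circ_shifts.
Proof.
rewrite has_cat has_map /circ.
rewrite -[has _ S]/(has (predU (fun s => j == i + s %[mod n])
  (fun s => j + s == i %[mod n]))%N S) has_predU.
congr (_ || _); apply: eq_in_has => s sS /=.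
move/allP: S_gen => /(_ _ sS) ?.
by rewrite -[RHS](eqn_modDr s) -addnA subnK ?modnDr //; lia.
Qed.

Hypothesis S_uniq : uniq S.

(** The strict bound 2s < n separates the generators from their opposites, so each neighbour is
    counted once. *)
Lemma circ_shifts_uniq : uniq circ_shifts.
Proof.
move/allP: S_gen => Sn.
rewrite cat_uniq S_uniq map_inj_in_uniq ?S_uniq ?andbT /=; last first.
  by move=> x y /Sn ? /Sn ?; lia.
by apply/hasPn=> _ /mapP[s /Sn ? ->]; apply/negP=> /Sn; lia.
Qed.

(** The powers of z form an eigenvector. This serves the Vandermonde diagonalisation and, with z =
    -1, the kernel vector over the original field. *)
Lemma circ_row_sum (R : nzRingType) (z : R) (i : 'I_n) : z ^+ n = 1 ->
  \sum_j (circ n S i j)%:R * z ^+ j = z ^+ i * circ_eigenvalue z.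
Proof.
move=> zn; have n_gt0 : (0 < n)%N by apply: leq_ltn_trans (ltn_ord i).
pose nb t : 'I_n := Ordinal (ltn_pmod (i + t) n_gt0).
have nb_uniq : uniq (map nb circ_shifts).
  rewrite map_inj_in_uniq ?circ_shifts_uniq // => s t sS tS /(congr1 val) /= /eqP.
  by rewrite eqn_modDl !modn_small ?circ_shifts_lt // => /eqP.
transitivity (\sum_(j in map nb circ_shifts) z ^+ j).
  rewrite [RHS]big_mkcond; apply: eq_bigr => j _ /=.
  suff -> : circ n S i j = (j \in map nb circ_shifts).
    by case: ifP; rewrite (mul1r, mul0r).
  rewrite circE; apply/hasP/mapP=> -[t tS].
    by move/eqP=> jE; exists t => //; apply/val_inj; rewrite /= -jE modn_small.
  by move=> ->; exists t => //=; rewrite modn_mod.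
rewrite -big_uniq //= big_map mulr_sumr; apply: eq_bigr => t _ /=.
by rewrite expr_mod // exprD.
Qed.

Lemma circ_char_poly (R : idomainType) (z : R) : n.-primitive_root z ->
  char_poly (adjacency_mx R (circ n S))
    = \prod_(k < n) ('X - (circ_eigenvalue (z ^+ k))%:P).
Proof.
move=> z_prim; pose a : 'rV[R]_n := \row_k z ^+ k.
pose d : 'rV[R]_n := \row_k circ_eigenvalue (z ^+ k).
rewrite (@char_poly_intertwine _ _ _ (diag_mx d) (Vandermonde n a)).
- rewrite char_poly_trig ?diag_mx_is_trig //.
  by apply: eq_bigr => k _; rewrite !mxE eqxx.
- rewrite det_Vandermonde; apply/prodf_neq0 => i _; apply/prodf_neq0 => j ij.
  rewrite !mxE subr_eq0 (eq_prim_root_expr z_prim) !modn_small //.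
  by rewrite eq_sym neq_ltn ij.
apply/matrixP => i k; rewrite mul_mx_diag !mxE -circ_row_sum; last first.
  by rewrite exprAC (prim_expr_order z_prim) expr1n.
by apply: eq_bigr => j _; rewrite !mxE.
Qed.

End Circulant.

(** The polynomial g: the quotient by y + 2 of the degree 7 polynomial in y = z + z^-1 that
    expresses the eigenvalue. *)
Definition circ7_factor (R : nzRingType) (y : R) : R :=
  y ^+ 6 - y ^+ 5 - 4%:R * y ^+ 4 + 3%:R * y ^+ 3 + 3%:R * y ^+ 2 - 1.

Lemma circ7_eigenvalueE (F : fieldType) (n : nat) (z : F) :
  (7 <= n)%N -> z ^+ n = 1 ->
  circ_eigenvalue n [:: 1; 2; 4; 5; 6; 7]%N z
    = (z + z^-1 + 2%:R) * circ7_factor (z + z^-1).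
Proof.
move=> n7 zn; have z0 : z != 0 by apply: root_unity_neq0 zn; lia.
have zB k : (k <= n)%N -> z ^+ (n - k) = z^-1 ^+ k.
  by move=> kn; rewrite expfB_cond ?(negbTE z0) // zn mul1r exprVn.
rewrite /circ_eigenvalue /circ_shifts /= !big_cons big_nil !zB; try lia.
by rewrite /circ7_factor; field.
Qed.

Lemma rmorph_circ7_factor (R S : nzRingType) (u : {rmorphism R -> S}) (y : R) :
  u (circ7_factor y) = circ7_factor (u y).
Proof.
by rewrite /circ7_factor !(rmorphB, rmorphD, rmorphM, rmorphXn, rmorph_nat, rmorph1).
Qed.

(** * Integral Bezout identities between g and its three transforms *)

Section Coprimality.

Variables (F : numFieldType) (y : F).
Hypothesis gy0 : circ7_factor y = 0.

(* The cofactors below come from the extended Euclidean algorithm. *)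
Lemma circ7_factor_opp : circ7_factor (- y) != 0.
Proof.
apply/eqP=> h; have /eqP : 2%:R = 0 :> F; last by rewrite pnatr_eq0.
transitivity ((- 1 + 2%:R * y - 3%:R * y ^+ 2 - 4%:R * y ^+ 3 + y ^+ 4 + y ^+ 5)
    * circ7_factor y
  + (- 1 - 2%:R * y - 3%:R * y ^+ 2 + 4%:R * y ^+ 3 + y ^+ 4 - y ^+ 5)
    * circ7_factor (- y)).
  by rewrite /circ7_factor; ring.
by rewrite gy0 h !mulr0 addr0.
Qed.

Lemma circ7_factor_sq : circ7_factor (y ^+ 2 - 2%:R) != 0.
Proof.
apply/eqP=> h; have /eqP : 18%:R = 0 :> F; last by rewrite pnatr_eq0.
transitivity ((- 94%:R - 152%:R * y + 122%:R * y ^+ 2 + 298%:R * y ^+ 3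
      - 51%:R * y ^+ 4 - 228%:R * y ^+ 5 + 15%:R * y ^+ 6 + 93%:R * y ^+ 7
      - 6%:R * y ^+ 8 - 21%:R * y ^+ 9 + y ^+ 10 + 2%:R * y ^+ 11)
    * circ7_factor y
  + (- 4%:R - 8%:R * y - 4%:R * y ^+ 2 + 4%:R * y ^+ 3 + y ^+ 4
      - 2%:R * y ^+ 5) * circ7_factor (y ^+ 2 - 2%:R)).
  by rewrite /circ7_factor; ring.
by rewrite gy0 h !mulr0 addr0.
Qed.

Lemma circ7_factor_opp_sq : circ7_factor (2%:R - y ^+ 2) != 0.
Proof.
apply/eqP=> h; have /eqP : 38%:R = 0 :> F; last by rewrite pnatr_eq0.
transitivity ((- 92%:R - 87%:R * y + 249%:R * y ^+ 2 + 436%:R * y ^+ 3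
      - 114%:R * y ^+ 4 - 456%:R * y ^+ 5 - 34%:R * y ^+ 6 + 188%:R * y ^+ 7
      + 28%:R * y ^+ 8 - 33%:R * y ^+ 9 - 4%:R * y ^+ 10 + 2%:R * y ^+ 11)
    * circ7_factor y
  + (- 18%:R - 29%:R * y - 17%:R * y ^+ 2 + 15%:R * y ^+ 3 + 6%:R * y ^+ 4
      - 2%:R * y ^+ 5) * circ7_factor (2%:R - y ^+ 2)).
  by rewrite /circ7_factor; ring.
by rewrite gy0 h !mulr0 addr0.
Qed.

End Coprimality.

(** * Galois conjugates of roots of unity *)

Lemma prim_root_half (R : idomainType) (m : nat) (z : R) :
  (0 < m)%N -> m.*2.-primitive_root z -> z ^+ m = -1.
Proof.
move=> m0 z_prim; apply/eqP; have := prim_expr_order z_prim.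
rewrite -muln2 exprM => /eqP; rewrite sqrf_eq1 => /orP[|//].
rewrite -(prim_order_dvd z_prim) => /dvdn_leq; lia.
Qed.

(* The three cases are [m] odd, [m] twice an odd number, and [4 %| m]. *)
Lemma prim_root_conj (m : nat) (z : algC) : m.-primitive_root z ->
  exists u : {rmorphism algC -> algC},
    [\/ u z = z ^+ 2, u z = - z ^+ 2 | u z = - z].
Proof.
move=> z_prim; have zm := prim_expr_order z_prim.
have m0 := prim_order_gt0 z_prim.
case: (boolP (odd m)) => [m_odd | m_even].
  have [|u uE] := @Qn_aut_exists 2 m; first by rewrite coprime2n.
  by exists u; constructor 1; rewrite uE.
have mE : m = m./2.*2 by lia.
have zhalf : z ^+ m./2 = -1 by apply: prim_root_half; [lia | rewrite -mE].
case: (boolP (odd m./2)) => [h_odd | h_even].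
  (* As z^(m/2) = -1, this exponent sends z to - z^2. It is odd and coprime to the odd number m/2,
     hence to m. *)
  have [|u uE] := @Qn_aut_exists (m./2 + 2) m.
    rewrite {2}mE -muln2 coprimeMr /coprime gcdnC gcdnDl -/(coprime _ _).
    by rewrite coprimen2 h_odd -/(coprime _ _) coprimen2 oddD h_odd.
  by exists u; constructor 2; rewrite uE // exprD zhalf mulN1r.
have [|u uE] := @Qn_aut_exists (m./2 + 1) m.
  rewrite {2}mE -muln2 coprimeMr /coprime gcdnC gcdnDl gcdn1 /=.
  by rewrite -/(coprime _ _) coprimen2 oddD (negbTE h_even).
by exists u; constructor 3; rewrite uE // exprD zhalf mulN1r.
Qed.

Lemma circ7_factor_root_unity (n : nat) (z : algC) :
  (0 < n)%N -> z ^+ n = 1 -> circ7_factor (z + z^-1) != 0.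
Proof.
move=> n0 zn; have [m z_prim _] := prim_order_exists n0 zn.
have z0 := root_unity_neq0 n0 zn.
apply/eqP=> gy0; have [u] := prim_root_conj z_prim.
(* Applying [u] shows that g vanishes at u z + (u z)^-1, which is y^2 - 2, 2 - y^2 or - y for y = z
   + z^-1. *)
have := congr1 u gy0; rewrite rmorph_circ7_factor rmorphD fmorphV rmorph0.
move=> + uz; apply/eqP; case: uz => ->.
- have -> : z ^+ 2 + (z ^+ 2)^-1 = (z + z^-1) ^+ 2 - 2%:R by field.
  exact: circ7_factor_sq.
- have -> : - z ^+ 2 + (- z ^+ 2)^-1 = 2%:R - (z + z^-1) ^+ 2 by field.
  exact: circ7_factor_opp_sq.
- have -> : - z + (- z)^-1 = - (z + z^-1) by field.
  exact: circ7_factor_opp.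
Qed.

Lemma circ7_eigenvalue_eq0 (n : nat) (z : algC) :
  ~~ odd n -> (7 <= n)%N -> z ^+ n = 1 ->
  (circ_eigenvalue n [:: 1; 2; 4; 5; 6; 7]%N z == 0) = (z == -1).
Proof.
move=> n_even n7 zn; have n0 : (0 < n)%N by lia.
have z0 := root_unity_neq0 n0 zn.
rewrite circ7_eigenvalueE // mulf_eq0.
rewrite (negbTE (circ7_factor_root_unity n0 zn)) orbF.
have -> : z + z^-1 + 2%:R = (z + 1) ^+ 2 / z by field.
by rewrite mulf_eq0 invr_eq0 (negbTE z0) orbF sqrf_eq0 addr_eq0.
Qed.

Theorem proposition7 (R : numFieldType) (n : nat)
    (n_even : ~~ odd n) (n_ge16 : (16 <= n)%N) :
  nut_graph R (circ n [:: 1; 2; 4; 5; 6; 7]%N).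
Proof.
set S := [:: 1; 2; 4; 5; 6; 7]%N.
(* The generator 7 requires 14 < n. *)
have S_gen : all (fun s => (0 < s) && (s.*2 < n))%N S by rewrite /=; lia.
have n7 : (7 <= n)%N by lia.
split; [|lia| |].
- by split; [exact: circ_sym | exact: circ_irr].
- have [|z z_prim] := @C_prim_root_exists n; first lia.
  have zh : z ^+ n./2 = -1.
    by apply: prim_root_half; [lia | have -> : n./2.*2 = n by lia].
  have h_lt : (n./2 < n)%N by lia.
  have zkn k : (z ^+ k) ^+ n = 1.
    by rewrite exprAC (prim_expr_order z_prim) expr1n.
  rewrite (mup0_char_poly_adjacency _ algC) (circ_char_poly S_gen _ z_prim) //.
  (* The index n/2, where the power of z is -1, contributes the factor 'X; the other powers differ
     from -1, so their factors do not vanish at 0. *)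
  rewrite (bigD1 (Ordinal h_lt)) //= mupMl.
    have /eqP -> : circ_eigenvalue n S (z ^+ n./2) == 0.
      by rewrite circ7_eigenvalue_eq0 // zh.
    by rewrite -['X - _]expr1 mup_XsubCX eqxx.
  rewrite /root horner_prod; apply/prodf_neq0 => k k_neq.
  rewrite hornerXsubC sub0r oppr_eq0 circ7_eigenvalue_eq0 // -zh.
  by rewrite (eq_prim_root_expr z_prim) !modn_small.
(* The eigenvector for the root of unity -1, available over any [R] because n is even. *)
- exists (\col_i (-1) ^+ i); have n0 : (0 < n)%N by lia.
  have v_neq0 i : (\col_(i < n) (-1) ^+ i : 'cV[R]_n) i 0 != 0.
    by rewrite mxE signr_eq0.
  split=> //.
    by apply: contraNneq (v_neq0 (Ordinal n0)) => ->; rewrite mxE.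
  have sgn_n : (-1 : R) ^+ n = 1 by rewrite -signr_odd (negbTE n_even).
  rewrite scale0r; apply/matrixP=> i j; rewrite !mxE.
  under eq_bigr do rewrite !mxE.
  rewrite (circ_row_sum S_gen) // circ7_eigenvalueE //.
  by rewrite invrN1 (_ : -1 + -1 + 2%:R = 0) ?mul0r ?mulr0 //; ring.
Qed.
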